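(* Let $H$ be a Hilbert space and let $A$ and $B$ be two unbounded linear operators in $H$, with domains $D(A)$ and $D(B)$, such that $A$, $B$ and all sums and products formed from them in this statement are densely defined. Suppose that $AB=BA$, that $A$ is invertible, that $B$ is closed, and that $D(BA^{-1})\subset D(A)$. Then $A+B$ is closed on $D(B)$; that is, $D(A+B)=D(B)$ and $A+B$ is a closed operator.
   Context: ''Unbounded operator'' means a linear operator defined on a linear subspace $D(A)$ of $H$, not necessarily bounded. For operators $A,B$: the sum $A+B$ has domain $D(A)\cap D(B)$; the product is $(BA)x=B(Ax)$ with domain $D(BA)=\{x\in D(A): Ax\in D(B)\}$. $A\subset B$ means $D(A)\subset D(B)$ and $A$, $B$ coincide on $D(A)$. Equality of operators includes equality of domains; in particular $AB=BA$ means $D(AB)=D(BA)$ and $ABx=BAx$ for all $x$ in this common domain. Standing assumption: all operators, together with any operation (sum, product) involving them or their adjoints, are densely defined; bounded operators are defined on all of $H$. An operator $A$ is invertible if there is an everywhere defined bounded operator, denoted $A^{-1}$, on $H$ with $A^{-1}A\subset AA^{-1}=I$. An operator is closed if its graph is closed in $H\times H$. *)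

(* Defs.v *)
(* MathComp-Analysis *)
From HB Require Import structures.
From mathcomp Require Import all_boot all_order all_algebra.
From mathcomp Require Import complex sesquilinear.
From mathcomp Require Import all_classical all_reals all_analysis.

Set Implicit Arguments.
Unset Strict Implicit.
Unset Printing Implicit Defensive.

Import Order.TTheory GRing.Theory Num.Theory.
Import numFieldNormedType.Exports.

Local Open Scope classical_set_scope.
Local Open Scope ring_scope.

(* Hilbert spaces may be real or complex. *)
Variant scalar_kind := RealScalars | ComplexScalars.

Definition scalar_field (R : realType) (k : scalar_kind) : numFieldType :=
  match k with
  | RealScalars => R
  | ComplexScalars => R[i]
  end.

Definition scalar_conj (R : realType) (k : scalar_kind) :
    scalar_field R k -> scalar_field R k :=
  match k with
  | RealScalars => idfun
  | ComplexScalars => @conjc R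
  end.

(* The norm of a complex normed module is valued in R[i], so `|x| ^+ 2 and
   inner x x live in the same type. *)
HB.mixin Record isHilbert (R : realType) (k : scalar_kind) H
    & CompleteNormedModule (scalar_field R k) H := {
  inner : {dot H for @scalar_conj R k} ;
  innerE : forall x : H, inner x x = `|x| ^+ 2
}.

#[short(type="hilbertType")]
HB.structure Definition Hilbert (R : realType) (k : scalar_kind) :=
  {H of CompleteNormedModule (scalar_field R k) H & isHilbert R k H}.

Section Operators.
Context {K : numFieldType} {H : normedModType K}.

(* The values of op_fun outside of dom are irrelevant: the notions below only
   evaluate an operator on its domain, and operators are compared with op_eq,
   not with Leibniz equality. *)
Record operator := Operator {
  dom : set H ;
  op_fun :> H -> H ;
  dom_submod : GRing.submod_closed (mem dom) ;
  op_linear : forall (a : K) (x y : H), dom x -> dom y ->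
    op_fun (a *: x + y) = a *: op_fun x + op_fun y
}.

Lemma dom_linear (A : operator) (a : K) (x y : H) :
  dom A x -> dom A y -> dom A (a *: x + y).
Proof.
by move=> Ax Ay; apply: set_mem; apply: (dom_submod A).2; apply/mem_set.
Qed.

Lemma dom0 (A : operator) : dom A 0.
Proof. by apply: set_mem; apply: (dom_submod A).1. Qed.

Lemma op0 (A : operator) : A 0 = 0.
Proof.
have := op_linear 1 (dom0 A) (dom0 A); rewrite !scale1r addr0.
by move/eqP; rewrite -subr_eq subrr eq_sym => /eqP.
Qed.

Lemma submod_closed_set (D : set H) : D 0 ->
  (forall (a : K) x y, D x -> D y -> D (a *: x + y)) ->
  GRing.submod_closed (mem D).
Proof.
move=> D0 DD; split; first exact/mem_set.
by move=> a x y /set_mem Dx /set_mem Dy; apply/mem_set/DD.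
Qed.

Lemma op_id_submod : GRing.submod_closed (mem [set: H]).
Proof. exact: submod_closed_set. Qed.

Definition op_id : operator :=
  @Operator setT idfun op_id_submod (fun _ _ _ _ _ => erefl).

Section Sum.
Variables A B : operator.

Lemma op_add_submod : GRing.submod_closed (mem (dom A `&` dom B)).
Proof.
apply: submod_closed_set; first by split; apply: dom0.
by move=> a x y [Ax Bx] [Ay By]; split; apply: dom_linear.
Qed.

Lemma op_add_linear (a : K) (x y : H) :
  (dom A `&` dom B) x -> (dom A `&` dom B) y ->
  A (a *: x + y) + B (a *: x + y) = a *: (A x + B x) + (A y + B y).
Proof.
by move=> [Ax Bx] [Ay By]; rewrite !op_linear// scalerDr addrACA.
Qed.

Definition op_add : operator :=
  @Operator (dom A `&` dom B) (fun x => A x + B x) op_add_submod op_add_linear.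

End Sum.

Section Product.
Variables B A : operator.

Lemma op_mul_submod :
  GRing.submod_closed (mem [set x | dom A x /\ dom B (A x)]).
Proof.
apply: submod_closed_set => [|a x y [Ax BAx] [Ay BAy]] /=.
  by rewrite op0; split; apply: dom0.
by rewrite op_linear//; split; apply: dom_linear.
Qed.

Lemma op_mul_linear (a : K) (x y : H) :
  [set x | dom A x /\ dom B (A x)] x -> [set x | dom A x /\ dom B (A x)] y ->
  B (A (a *: x + y)) = a *: B (A x) + B (A y).
Proof. by move=> [Ax BAx] [Ay BAy]; rewrite !op_linear. Qed.

Definition op_mul : operator :=
  @Operator [set x | dom A x /\ dom B (A x)] (fun x => B (A x))
    op_mul_submod op_mul_linear.

End Product.

Definition op_incl (A B : operator) : Prop :=
  dom A `<=` dom B /\ forall x, dom A x -> A x = B x.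

Definition op_eq (A B : operator) : Prop :=
  dom A = dom B /\ forall x, dom A x -> A x = B x.

Definition densely_defined (A : operator) : Prop := dense (dom A).

Definition closed_operator (A : operator) : Prop :=
  closed [set p : H * H | dom A p.1 /\ p.2 = A p.1].

Definition bounded_operator (A : operator) : Prop :=
  dom A = setT /\ exists M : K, forall x, `|A x| <= M * `|x|.

Definition is_inverse (A Ainv : operator) : Prop :=
  [/\ bounded_operator Ainv,
      op_incl (op_mul Ainv A) (op_mul A Ainv) &
      op_eq (op_mul A Ainv) op_id].

Definition invertible (A : operator) : Prop :=
  exists Ainv : operator, is_inverse A Ainv.

(* The choice is immaterial, since is_inverse determines the inverse up to
   op_eq. *)
Definition op_inv (A : operator) (hA : invertible A) : operator :=
  projT1 (cid hA).

End Operators.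

Arguments operator {K} H.

(* Main.v *)
(* Put S = A^-1.  Since B commutes with A, S B is contained in B S, and a pair
   (x, y) lies in the graph of A + B exactly when (S x, S y - x) lies in the
   graph of B: for the converse, S x in D(B) gives x in D(A) by the domain
   hypothesis, so B S x = S (y - A x) is in D(A), and commutation applied to S x
   returns x in D(B) and B x = y - A x.  Hence the graph of A + B is the preimage
   of a closed set under a continuous map. *)
Require Import Defs.
From HB Require Import structures.
From mathcomp Require Import all_boot all_order all_algebra.
From mathcomp Require Import all_classical all_reals all_analysis.
Set Implicit Arguments.
Unset Strict Implicit.
Unset Printing Implicit Defensive.
Import numFieldNormedType.Exports.
Local Open Scope classical_set_scope.
Local Open Scope ring_scope.

Import Order.TTheory GRing.Theory Num.Theory.

Section CommutingInverse.
Context {K : numFieldType} {H : normedModType K}.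
Implicit Types A B S : operator H.

Lemma bounded_operatorB S x y :
  bounded_operator S -> S (x - y) = S x - S y.
Proof.
move=> [domS _]; rewrite -[x - y]addrC -scaleN1r op_linear ?domS//.
by rewrite scaleN1r addrC.
Qed.

Lemma bounded_operator_continuous S :
  bounded_operator S -> continuous (S : H -> H).
Proof.
move=> bS; have [_ [M SM]] := bS.
have S_linear : linear (S : H -> H).
  by move=> a x y; rewrite op_linear// bS.1.
pose linS := GRing.isLinear.Build K H H *:%R (S : H -> H) S_linear.
pose f : {linear H -> H} := HB.pack (S : H -> H) linS.
apply: (@bounded_linear_continuous K H H f).
apply/linear_boundedP.
(* The scalar [M] need not be real, so its norm serves as the bound. For each [x], the product of
   [M] with the norm of [x] is nonnegative, hence equals its own norm. *)
exists `|M|; split=> [|r Mr x]; first exact: normr_real.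
rewrite (le_trans (SM x))// -(ger0_norm (le_trans (normr_ge0 _) (SM x))).
by rewrite normrM normr_id ler_wpM2r// ltW.
Qed.

Variables A B S : operator H.
Hypothesis invA : is_inverse A S.
Hypothesis ABcomm : op_eq (op_mul A B) (op_mul B A).

Lemma inverse_mulK x : dom A (S x) /\ A (S x) = x.
Proof.
have [_ _ [domAS AS]] := invA.
have : dom (op_mul A S) x by rewrite domAS.
by move=> ASx; split; [exact: ASx.2|exact: AS].
Qed.

Lemma inverse_Kmul x : dom A x -> S (A x) = x.
Proof.
have [[domS _] [_ SA] _] := invA => Ax.
(* The inclusion of [S A] in [A S] turns [S (A x)] into [A (S x)], which is [x]. *)
by rewrite [LHS]SA/= ?(inverse_mulK x).2//; split => //; rewrite domS.
Qed.

(** Since [A (S x) = x] lies in D(B), [S x] lies in D(BA) = D(AB). There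
    [A (B (S x)) = B (A (S x)) = B x], and applying [S] cancels [A]. *)
Lemma inverse_comm x : dom B x -> dom B (S x) /\ B (S x) = S (B x).
Proof.
move=> Bx; have [ASx ASK] := inverse_mulK x.
have BASx : dom (op_mul B A) (S x) by split=> //; rewrite ASK.
have ABSx : dom (op_mul A B) (S x) by rewrite ABcomm.1.
split; first exact: ABSx.1.
rewrite -[LHS]inverse_Kmul; last exact: ABSx.2.
by have /= -> := ABcomm.2 _ ABSx; rewrite ASK.
Qed.

Hypothesis domBS : dom (op_mul B S) `<=` dom A.

Lemma dom_inv_sub : dom B `<=` dom A.
Proof.
move=> x /inverse_comm[BSx _]; apply: domBS; split=> //.
by have [[->]] := invA.
Qed.

Lemma dom_add_inv : dom (op_add A B) = dom B.
Proof. by rewrite /= setIC; apply/setIidl/dom_inv_sub. Qed.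

Lemma graph_add_inv x y :
  (dom (op_add A B) x /\ y = op_add A B x) <->
  (dom B (S x) /\ S y - x = B (S x)).
Proof.
have [bS _ _] := invA; split=> [[[Ax Bx] ->]|[BSx e]].
  have [BSx ->] := inverse_comm Bx; split=> //.
  (* Writing the subtracted [x] as [S (A x)] leaves [S (A x + B x - A x)]. *)
  rewrite /= -[X in _ - X](inverse_Kmul Ax) -bounded_operatorB//.
  by rewrite addrAC subrr add0r.
have Ax : dom A x by apply: domBS; split=> //; rewrite bS.1.
have {}e : B (S x) = S (y - A x) by rewrite bounded_operatorB// inverse_Kmul.
(* [y - A x] is the value expected for [B x]; as [S] maps into D(A), [B (S x)] lies in D(A). *)
have [ASx ASK] := inverse_mulK x; have [AyAx yAxK] := inverse_mulK (y - A x).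
have ABSx : dom (op_mul A B) (S x) by split=> //; rewrite e.
have BASx : dom (op_mul B A) (S x) by rewrite -ABcomm.1.
have Bx : dom B x by rewrite -ASK; exact: BASx.2.
split=> //=; have /= := ABcomm.2 _ ABSx.
by rewrite e yAxK ASK => <-; rewrite addrC subrK.
Qed.

Lemma closed_add_inv : closed_operator B -> closed_operator (op_add A B).
Proof.
have [bS _ _] := invA; have cS := bounded_operator_continuous bS.
move=> Bcl; pose F (p : H * H) := (S p.1, S p.2 - p.1).
rewrite /closed_operator (_ : mkset _ =
    F @^-1` [set p | dom B p.1 /\ p.2 = B p.1]); last first.
  by apply/seteqP; split=> -[x y] /graph_add_inv.
apply: preimage_closed Bcl => p _.
apply: cvg_pair; first exact: (continuous_comp cvg_fst (cS _)).
by apply: cvgB; [exact: (continuous_comp cvg_snd (cS _))|exact: cvg_fst].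
Qed.

End CommutingInverse.

Theorem theorem2 (R : realType) (k : scalar_kind) (H : hilbertType R k)
  (A B : operator H)
  (hA : invertible A)
  (A_dense : densely_defined A)
  (B_dense : densely_defined B)
  (AB_dense : densely_defined (op_mul A B))
  (BA_dense : densely_defined (op_mul B A))
  (AaddB_dense : densely_defined (op_add A B))
  (BAinv_dense : densely_defined (op_mul B (op_inv hA)))
  (ABcomm : op_eq (op_mul A B) (op_mul B A))
  (B_closed : closed_operator B)
  (hdom : dom (op_mul B (op_inv hA)) `<=` dom A) :
  dom (op_add A B) = dom B /\ closed_operator (op_add A B).
Proof.
have invA : is_inverse A (op_inv hA) := projT2 (cid hA).
split; first exact: (dom_add_inv invA ABcomm hdom).
exact: (closed_add_inv invA ABcomm hdom).
Qed.
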